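(* Let $n\ge 2$ be an even integer. In every saturated pure partial plane of order $n$ there is a point that lies on at least $3$ lines.
   Context: A pure partial plane of order $n$ and size $s$ is a set $X$ of $n^2+n+1$ points together with a collection of $s$ distinct lines, each line being a subset of $X$ of cardinality $n+1$, such that any two distinct lines intersect in exactly one point. It is saturated if no $(n+1)$-subset of $X$ other than the existing lines meets every existing line in exactly one point (so no line can be added keeping it a pure partial plane). *)

(* Defs.v *)
From mathcomp Require Import all_boot.
Set Implicit Arguments.
Unset Strict Implicit.
Unset Printing Implicit Defensive.

Record pure_partial_plane (n s : nat) (X : finType) (L : {set {set X}}) : Prop :=
  PurePartialPlane {
    ppp_points : #|X| = n ^ 2 + n + 1;
    ppp_size : #|L| = s;
    ppp_line_card : forall l : {set X}, l \in L -> #|l| = n + 1;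
    ppp_meet : forall l m : {set X},
      l \in L -> m \in L -> l <> m -> #|l :&: m| = 1
  }.

Definition saturated (n : nat) (X : finType) (L : {set {set X}}) : Prop :=
  ~ exists A : {set X},
      [/\ #|A| = n + 1, A \notin L & forall l : {set X}, l \in L -> #|A :&: l| = 1].

(* Main.v *)
Require Import Defs.
From mathcomp Require Import all_boot zify.

Set Implicit Arguments.
Unset Strict Implicit.
Unset Printing Implicit Defensive.

(** Suppose every point lies on at most two lines.  Counting incidences shows
    that each line has [n + 2 - s] points lying on no other line, and that the
    number [c] of covered points satisfies [2 c + s (n + s) = 3 s (n + 1)].  If
    [s <= n + 1], choose on each line a point lying on no other line.  If
    [s = n + 2], which is even, pair up the lines and take the intersection point
    of each pair.  Either way we get a set of covered points meeting each line
    exactly once, and there are enough uncovered points to enlarge it to a set of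
    [n + 1] points, contradicting saturation. *)

Definition degree (X : finType) (L : {set {set X}}) (x : X) : nat :=
  #|[set l in L | x \in l]|.

Lemma degreeE (X : finType) (L : {set {set X}}) (x : X) :
  degree L x = \sum_(l in L) (x \in l).
Proof.
rewrite /degree -sum1_card big_mkcond [RHS]big_mkcond.
by apply: eq_bigr => l _; rewrite inE; case: (l \in L); case: (x \in l).
Qed.

Lemma degree_gt0 (X : finType) (L : {set {set X}}) (x : X) :
  (0 < degree L x) = (x \in cover L).
Proof.
apply/card_gt0P/bigcupP => [[l]|[l lL xl]]; last by exists l; rewrite inE lL.
by rewrite inE => /andP[lL xl]; exists l.
Qed.

Lemma sum_degree_in (X : finType) (L : {set {set X}}) (A : {set X}) :
  \sum_(x in A) degree L x = \sum_(l in L) #|A :&: l|.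
Proof.
under eq_bigr do rewrite degreeE.
rewrite exchange_big; apply: eq_bigr => l _.
rewrite -sum1_card big_mkcond [RHS]big_mkcond.
by apply: eq_bigr => x _; rewrite inE; case: (x \in A); case: (x \in l).
Qed.

Lemma degree1_uniq (X : finType) (L : {set {set X}}) (x : X) (l m : {set X}) :
  degree L x = 1 -> l \in L -> m \in L -> x \in l -> x \in m -> l = m.
Proof.
move=> /eqP/cards1P[k Ek] lL mL xl xm.
have: l \in [set k] by rewrite -Ek inE lL.
have: m \in [set k] by rewrite -Ek inE mL.
by rewrite !inE => /eqP-> /eqP->.
Qed.

Lemma degree2_pair (X : finType) (L : {set {set X}}) (x : X)
    (l m k : {set X}) :
  degree L x <= 2 -> l \in L -> m \in L -> k \in L -> l != m ->
  x \in l -> x \in m -> (x \in k) = (k == l) || (k == m).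
Proof.
move=> d2 lL mL kL lm xl xm; apply/idP/orP => [xk|[]/eqP-> //].
have sub : [set l; m] \subset [set l in L | x \in l].
  by apply/subsetP => j; rewrite !inE => /orP[]/eqP->; rewrite ?lL ?mL.
have : [set l; m] == [set l in L | x \in l] by rewrite eqEcard sub cards2 lm.
by move/eqP/setP/(_ k); rewrite !inE kL xk => /orP.
Qed.

Lemma exists_subset_card (X : finType) (A : {set X}) (k : nat) :
  k <= #|A| -> exists2 B : {set X}, B \subset A & #|B| = k.
Proof.
case/card_geqP => t [ut <- tA]; exists [set x in t].
  by apply/subsetP => x; rewrite inE; apply: tA.
by rewrite cardsE; apply/card_uniqP.
Qed.

(** Count incidences between points of [l] and lines: [l] itself contributes [n + 1], and each of
    the other [s - 1] lines contributes [1]. *)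
Lemma sum_degree_line (n s : nat) (X : finType) (L : {set {set X}})
    (l : {set X}) :
  pure_partial_plane n s L -> l \in L -> \sum_(x in l) degree L x = n + s.
Proof.
case=> _ sL cL mL lL; rewrite sum_degree_in (bigD1 l) //= setIid cL //.
rewrite (eq_bigr (fun=> 1)) => [|m /andP[mLL /eqP ml]]; last first.
  by apply: mL => //; apply: nesym.
rewrite sum1_card -sL (cardsD1 l L) lL addnA; congr (_ + _).
by apply: eq_card => m; rewrite !inE andbC.
Qed.

(** Points of [l] have degree 1 or 2, so adding 1 to the degree of those of degree 1 makes every
    summand 2. The additive form avoids truncated subtraction and also yields [s <= n + 2]. *)
Lemma card_degree1_line (n s : nat) (X : finType) (L : {set {set X}})
    (l : {set X}) :
  pure_partial_plane n s L -> (forall x, degree L x <= 2) -> l \in L ->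
  #|[set x in l | degree L x == 1]| + s = n + 2.
Proof.
move=> P d2 lL; have Sl := sum_degree_line P lL.
have : \sum_(x in l) (degree L x + (degree L x == 1)) = 2 * #|l|.
  rewrite mulnC -sum_nat_const; apply: eq_bigr => x xl.
  have : 0 < degree L x by rewrite degree_gt0; apply/bigcupP; exists l.
  by have := d2 x; case: (degree L x) => [|[|[|]]].
rewrite big_split /= Sl (ppp_line_card P lL).
suff -> : \sum_(x in l) (degree L x == 1) = #|[set x in l | degree L x == 1]|
  by lia.
rewrite -sum1_card big_mkcond [RHS]big_mkcond; apply: eq_bigr => x _.
by rewrite inE; case: (x \in l); case: (_ == 1).
Qed.

(* For [d <= 2] one has [d ^ 2 + 2 [0 < d] = 3 d]; sum this over all degrees. *)
Lemma card_cover_degree_le2 (n s : nat) (X : finType) (L : {set {set X}}) :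
  pure_partial_plane n s L -> (forall x, degree L x <= 2) ->
  s * (n + s) + 2 * #|cover L| = 3 * (s * (n + 1)).
Proof.
move=> P d2.
have sumd : \sum_x degree L x = s * (n + 1).
  have := sum_degree_in L [set: X]; rewrite big_mkcond /=.
  under eq_bigr do rewrite inE.
  move=> ->; rewrite -(ppp_size P) -sum_nat_const; apply: eq_bigr => l lL.
  by rewrite setTI (ppp_line_card P).
have sumd2 : \sum_x degree L x * degree L x = s * (n + s).
  rewrite -[X in X * (n + s)](ppp_size P) -sum_nat_const.
  (* A point of degree [d] lies in [d] of the inner sums and contributes [d] to each. *)
  transitivity (\sum_(l in L) \sum_(x in l) degree L x); last first.
    by apply: eq_bigr => l lL; apply: sum_degree_line.
  under [RHS]eq_bigr do rewrite big_mkcond.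
  rewrite exchange_big; apply: eq_bigr => x _.
  rewrite {1}degreeE big_distrl; apply: eq_bigr => l _ /=.
  by case: (x \in l); rewrite ?mul1n.
have sumc : \sum_x (x \in cover L) = #|cover L|.
  by rewrite -sum1_card [RHS]big_mkcond; apply: eq_bigr => x _; case: ifP.
rewrite -sumd -sumd2 -sumc !big_distrr -big_split /=.
apply: eq_bigr => x _; rewrite -degree_gt0.
by have := d2 x; case: (degree L x) => [|[|[|]]].
Qed.

Lemma exists_degree1_transversal (X : finType) (L : {set {set X}}) :
  (forall l, l \in L -> exists2 x, x \in l & degree L x = 1) ->
  exists B : {set X}, [/\ B \subset cover L, #|B| = #|L| &
    forall l, l \in L -> #|B :&: l| = 1].
Proof.
move=> ex1.
(* [x0] only serves as the default of the choice function [f]; if [X] is empty, the hypothesis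
   leaves no lines. *)
have [x0 _|noX] := pickP (@predT X); last first.
  have L0 : L = set0.
    apply/setP => l; rewrite inE; apply/negP => /ex1[x _ _].
    by have := noX x.
  by exists set0; rewrite sub0set L0 !cards0; split=> // l; rewrite inE.
pose f (l : {set X}) := odflt x0 [pick x in l | degree L x == 1].
have fP l : l \in L -> f l \in l /\ degree L (f l) = 1.
  rewrite /f => /ex1[x xl dx]; case: pickP => [y /andP[? /eqP] //|/(_ x)].
  by rewrite xl dx.
have fU l m : l \in L -> m \in L -> f l \in m -> l = m.
  move=> lL mL flm; have [fl d1] := fP l lL.
  exact: degree1_uniq d1 lL mL fl flm.
exists (f @: L); split.
- apply/subsetP => _ /imsetP[l lL ->].
  by apply/bigcupP; exists l => //; case: (fP l lL).
- apply: card_in_imset => l m lL mL fE; apply: fU => //.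
  by rewrite fE; case: (fP m mL).
move=> l lL; apply/eqP/cards1P; exists (f l); apply/setP => x; rewrite !inE.
apply/andP/eqP => [[/imsetP[m mL ->] fml]|->].
  by rewrite (fU m l).
by split; [apply: imset_f | case: (fP l lL)].
Qed.

(* A perfect matching of the lines of [M] is built two lines at a time: their
   common point lies on no third line. *)
Lemma exists_matching_points (n s : nat) (X : finType) (L M : {set {set X}})
    (k : nat) :
  pure_partial_plane n s L -> (forall x, degree L x <= 2) ->
  M \subset L -> #|M| = k.*2 ->
  exists B : {set X}, [/\ B \subset cover L, #|B| = k &
    forall l, l \in L -> #|B :&: l| = (l \in M)].
Proof.
move=> P d2; elim: k M => [|k IH] M ML cM.
  exists set0; rewrite sub0set cards0; split => // l _.
  by rewrite set0I cards0 (cards0_eq cM) inE.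
have /card_gt1P[l [m [lM mM lm]]] : 1 < #|M| by rewrite cM doubleS.
have [lL mL] : l \in L /\ m \in L by split; apply: (subsetP ML).
have /eqP/cards1P[x Ex] := ppp_meet P lL mL (elimN eqP lm).
have /setIP[xl xm] : x \in l :&: m by rewrite Ex inE.
have xE j (jL : j \in L) := degree2_pair (d2 x) lL mL jL lm xl xm.
have [||B [Bc cB BM]] := IH (M :\: [set l; m]).
- exact: subset_trans (subsetDl _ _) ML.
- have sub : [set l; m] \subset M.
    by apply/subsetP => j; rewrite !inE => /orP[]/eqP->.
  by rewrite cardsD (setIidPr sub) cards2 lm cM; lia.
(* [l] was removed before the induction hypothesis was applied, so [B] misses [l], while [x] lies on
   it. *)
have xB : x \notin B.
  apply/negP => xB; have := BM l lL; rewrite !inE eqxx /= => /cards0_eq/setP.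
  by move/(_ x); rewrite !inE xB xl.
exists (x |: B); split.
- rewrite subUset sub1set Bc andbT; by apply/bigcupP; exists l.
- by rewrite cardsU1 xB cB.
move=> j jL; rewrite setIUl.
have := BM j jL; rewrite !inE; case: (boolP ((j == l) || (j == m))) => jlm /=.
  move/cards0_eq ->; rewrite setU0.
  have -> : j \in M by case/orP: jlm => /eqP->.
  have -> : [set x] :&: j = [set x]; last by rewrite cards1.
  by apply/setIidPl; rewrite sub1set xE.
move=> <-; congr #|pred_of_set _|; apply/setP => y; rewrite !inE.
by case: eqP => // ->; rewrite xE // (negPf jlm) andbF.
Qed.

(** Padding [B] with uncovered points changes no intersection with a line, so saturation forbids
    reaching [n + 1] points this way. *)
Lemma saturated_transversal_lt (n s : nat) (X : finType) (L : {set {set X}})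
    (B : {set X}) :
  0 < n -> pure_partial_plane n s L -> saturated n L ->
  B \subset cover L -> (forall l, l \in L -> #|B :&: l| = 1) ->
  #|B| <= n + 1 -> #|B| + #|~: cover L| < n + 1.
Proof.
move=> n0 P sat Bc BL Bn; rewrite ltnNge; apply/negP => le.
have [|C CU cC] := @exists_subset_card X (~: cover L) (n + 1 - #|B|).
  by lia.
have AL l : l \in L -> #|(B :|: C) :&: l| = 1.
  move=> lL; rewrite setIUl.
  have -> : C :&: l = set0; last by rewrite setU0 BL.
  apply/setP => x; rewrite !inE; apply/negP => /andP[/(subsetP CU)].
  by rewrite inE => /bigcupP xc xl; apply: xc; exists l.
have cA : #|B :|: C| = n + 1.
  rewrite cardsU; have -> : B :&: C = set0; last by rewrite cards0; lia.
  apply/setP => x; rewrite !inE; apply/negP => /andP[/(subsetP Bc) xB].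
  by move/(subsetP CU); rewrite inE xB.
apply: sat; exists (B :|: C); split => //.
(* Were the padded set a line, it would meet itself in [n + 1 > 1] points. *)
by apply/negP => /AL; rewrite setIid cA; lia.
Qed.

Theorem theorem2 (n s : nat) (X : finType) (L : {set {set X}})
  (n_ge2 : 2 <= n) (n_even : ~~ odd n)
  (planeL : pure_partial_plane n s L) (satL : saturated n L) :
  exists x : X, 3 <= #|[set l in L | x \in l]|.
Proof.
apply/existsP; apply: contraT; rewrite negb_exists => /forallP d3.
have d2 x : degree L x <= 2 by have := d3 x; rewrite -ltnNge.
have n_gt0 : 0 < n by apply: ltnW.
have cC := card_cover_degree_le2 planeL d2.
have cU := cardsC (cover L); rewrite (ppp_points planeL) in cU.
have p1 l (lL : l \in L) := card_degree1_line planeL d2 lL.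
have s_le : s <= n + 2.
  have [L0|[l lL]] := set_0Vmem L; last by have := p1 l lL; lia.
  by rewrite -(ppp_size planeL) L0 cards0.
have [s_le1|s_gt] := leqP s (n + 1).
  have [l lL|B [Bc cB BL]] := @exists_degree1_transversal X L.
    have : 0 < #|[set x in l | degree L x == 1]| by have := p1 l lL; lia.
    by case/card_gt0P => x; rewrite inE => /andP[xl /eqP]; exists x.
  rewrite (ppp_size planeL) in cB.
  have := saturated_transversal_lt n_gt0 planeL satL Bc BL.
  rewrite cB => /(_ s_le1); clear -n_ge2 cC cU s_le1.
  (* With [u] uncovered points, [2 (s + u - (n + 1)) = 2 n (t - 1) + s (s - 1)]. This is
     nonnegative: clearly if [t >= 1], and it equals [n (n - 1)] if [t = 0]. *)
  have [t Et] : exists t, s + t = n + 1 by exists (n + 1 - s); lia.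
  by nia.
have sE : s = n + 2 by lia.
have [k nk] : exists k, n = k.*2.
  by exists n./2; rewrite -[LHS]odd_double_half (negPf n_even).
have [//||B [Bc cB BL]] :=
  @exists_matching_points n s X L L k.+1 planeL d2.
  by rewrite (ppp_size planeL) sE nk; lia.
have BL1 l : l \in L -> #|B :&: l| = 1 by move=> lL; rewrite BL // lL.
have := saturated_transversal_lt n_gt0 planeL satL Bc BL1.
have kn : k.+1 <= n + 1 by lia.
(* Here [n (n - 1) / 2] points are uncovered and [B] has [n / 2 + 1], in total [n ^ 2 / 2 + 1],
   which is at least [n + 1] since [n >= 2]. *)
rewrite cB => /(_ kn); clear -n_ge2 cC cU sE nk; by nia.
Qed.
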